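(* For all formulae $A,B$, the following formulae are derivable in $\mathbf{GAMALL}$: (1) $\Diamond(\boxdot A\to\boxdot\boxdot A)$; (2) $\Diamond(\Diamond A\to\boxdot\Diamond A)$; (3) $\Diamond(A\to\boxdot\Diamond A)$; (4) $\Diamond(\Diamond A\to A)$; (5) $\Diamond(A\to\boxdot A)$; (6) $\Diamond(A\to\boxdot B)\to\Diamond(\boxdot A\to B)$.
   Context: Formulae are built from propositional variables and constants $0,1,\bot,\top$ using the connectives $\otimes$, $\oplus$ (multiplicative disjunction, ''par''), $\land$, $\lor$ (additive conjunction and disjunction), $\neg$, $\to$. A sequent $\Gamma\Rightarrow\Delta$ is a pair of finite multisets of formulae; commas denote multiset union. A formula $C$ is derivable in a calculus if the sequent ${}\Rightarrow C$ is derivable. The calculus $\mathbf{GMALL}$ for Multiplicative Additive Linear Logic has the following rules (no cut, weakening or contraction). Axioms: $A\Rightarrow A$; $0\Rightarrow{}$; ${}\Rightarrow 1$; $\bot,\Gamma\Rightarrow\Delta$; $\Gamma\Rightarrow\Delta,\top$. $(R0)$ from $\Gamma\Rightarrow\Delta$ infer $\Gamma\Rightarrow\Delta,0$. $(L1)$ from $\Gamma\Rightarrow\Delta$ infer $1,\Gamma\Rightarrow\Delta$. $(L\otimes)$ from $\Gamma,A,B\Rightarrow\Delta$ infer $A\otimes B,\Gamma\Rightarrow\Delta$. $(R\otimes)$ from $\Gamma\Rightarrow\Delta,A$ and $\Gamma'\Rightarrow\Delta',B$ infer $\Gamma,\Gamma'\Rightarrow\Delta,\Delta',A\otimes B$.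 $(L\oplus)$ from $A,\Gamma\Rightarrow\Delta$ and $B,\Gamma'\Rightarrow\Delta'$ infer $A\oplus B,\Gamma,\Gamma'\Rightarrow\Delta,\Delta'$. $(R\oplus)$ from $\Gamma\Rightarrow\Delta,A,B$ infer $\Gamma\Rightarrow\Delta,A\oplus B$. $(L\land_1),(L\land_2)$ from $A,\Gamma\Rightarrow\Delta$, respectively from $B,\Gamma\Rightarrow\Delta$, infer $A\land B,\Gamma\Rightarrow\Delta$. $(R\land)$ from $\Gamma\Rightarrow\Delta,A$ and $\Gamma\Rightarrow\Delta,B$ infer $\Gamma\Rightarrow\Delta,A\land B$. $(L\lor)$ from $A,\Gamma\Rightarrow\Delta$ and $B,\Gamma\Rightarrow\Delta$ infer $A\lor B,\Gamma\Rightarrow\Delta$. $(R\lor_1),(R\lor_2)$ from $\Gamma\Rightarrow\Delta,A$, respectively from $\Gamma\Rightarrow\Delta,B$, infer $\Gamma\Rightarrow\Delta,A\lor B$. $(L\neg)$ from $\Gamma\Rightarrow\Delta,A$ infer $\neg A,\Gamma\Rightarrow\Delta$. $(R\neg)$ from $A,\Gamma\Rightarrow\Delta$ infer $\Gamma\Rightarrow\Delta,\neg A$. $(L\to)$ from $\Gamma\Rightarrow\Delta,A$ and $B,\Gamma'\Rightarrow\Delta'$ infer $A\to B,\Gamma,\Gamma'\Rightarrow\Delta,\Delta'$. $(R\to)$ from $A,\Gamma\Rightarrow\Delta,B$ infer $\Gamma\Rightarrow\Delta,A\to B$. $\mathbf{GAMALL}$ (a calculus for Affine Logic) is $\mathbf{GMALL}$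 extended with the weakening rules $(LW)$: from $\Gamma\Rightarrow\Delta$ infer $A,\Gamma\Rightarrow\Delta$; $(RW)$: from $\Gamma\Rightarrow\Delta$ infer $\Gamma\Rightarrow\Delta,A$. The Tarskian modalities are the abbreviations $\Diamond A := \neg A\to A$ and $\boxdot A := \neg\Diamond\neg A$. *)

(* Defs.v *)
From HB Require Import structures.
From mathcomp Require Import all_boot finmap multiset.

Set Implicit Arguments.
Unset Strict Implicit.
Unset Printing Implicit Defensive.

Inductive formula : Type :=
| Var of nat
| Zero
| One
| Bot
| Top
| Tensor of formula & formula
| Par of formula & formula
| And of formula & formula
| Or of formula & formula
| Neg of formula
| Imp of formula & formula.

Declare Scope mall_scope.
Delimit Scope mall_scope with mall.
Bind Scope mall_scope with formula.
Open Scope mset_scope.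
Open Scope mall_scope.

Notation "¬ A" := (Neg A)
  (at level 35, right associativity, format "¬ A") : mall_scope.
Notation "A ⊗ B" := (Tensor A B) (at level 40, left associativity) : mall_scope.
Notation "A ⊕ B" := (Par A B) (at level 43, left associativity) : mall_scope.
Notation "A ∧ B" := (And A B) (at level 40, left associativity) : mall_scope.
Notation "A ∨ B" := (Or A B) (at level 43, left associativity) : mall_scope.
Notation "A → B" := (Imp A B) (at level 45, right associativity) : mall_scope.

(* Finite multisets [{mset K}] require a choiceType [K]; formulae get this
   structure through an embedding into generic trees. *)
Fixpoint tree_of_formula (A : formula) : GenTree.tree nat :=
  match A with
  | Var n => GenTree.Leaf n
  | Zero => GenTree.Node 0 [::]
  | One => GenTree.Node 1 [::]
  | Bot => GenTree.Node 2 [::]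
  | Top => GenTree.Node 3 [::]
  | A ⊗ B => GenTree.Node 4 [:: tree_of_formula A; tree_of_formula B]
  | A ⊕ B => GenTree.Node 5 [:: tree_of_formula A; tree_of_formula B]
  | A ∧ B => GenTree.Node 6 [:: tree_of_formula A; tree_of_formula B]
  | A ∨ B => GenTree.Node 7 [:: tree_of_formula A; tree_of_formula B]
  | ¬ A => GenTree.Node 8 [:: tree_of_formula A]
  | A → B => GenTree.Node 9 [:: tree_of_formula A; tree_of_formula B]
  end.

Fixpoint formula_of_tree (t : GenTree.tree nat) : option formula :=
  let bin c t1 t2 :=
    obind (fun A => omap (c A) (formula_of_tree t2)) (formula_of_tree t1) in
  match t with
  | GenTree.Leaf n => Some (Var n)
  | GenTree.Node 0 [::] => Some Zero
  | GenTree.Node 1 [::] => Some One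
  | GenTree.Node 2 [::] => Some Bot
  | GenTree.Node 3 [::] => Some Top
  | GenTree.Node 4 [:: t1; t2] => bin Tensor t1 t2
  | GenTree.Node 5 [:: t1; t2] => bin Par t1 t2
  | GenTree.Node 6 [:: t1; t2] => bin And t1 t2
  | GenTree.Node 7 [:: t1; t2] => bin Or t1 t2
  | GenTree.Node 8 [:: t1] => omap Neg (formula_of_tree t1)
  | GenTree.Node 9 [:: t1; t2] => bin Imp t1 t2
  | _ => None
  end.

Lemma tree_of_formulaK : pcancel tree_of_formula formula_of_tree.
Proof.
by elim=> //= [A -> B ->|A -> B ->|A -> B ->|A -> B ->|A ->|A -> B ->].
Qed.

HB.instance Definition _ := Countable.copy formula (pcan_type tree_of_formulaK).

Definition sequent : Type := ({mset formula} * {mset formula})%type.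

Notation "Γ ⇒ Δ" := ((Γ, Δ) : sequent) (at level 70, no associativity).

(* A calculus is given by its rule instances: [R premises conclusion]. *)
Definition calculus := seq sequent -> sequent -> Prop.

Inductive derivable_sequent (R : calculus) : sequent -> Prop :=
| derivable_by premises s :
    R premises s ->
    (forall p, p \in premises -> derivable_sequent R p) ->
    derivable_sequent R s.

Definition derivable (R : calculus) (C : formula) : Prop :=
  derivable_sequent R (mset0 ⇒ [mset C]).

Inductive GMALL : calculus :=
| Ax A : GMALL [::] ([mset A] ⇒ [mset A])
| AxL0 : GMALL [::] ([mset Zero] ⇒ mset0)
| AxR1 : GMALL [::] (mset0 ⇒ [mset One])
| AxLBot Γ Δ : GMALL [::] (Bot +` Γ ⇒ Δ)
| AxRTop Γ Δ : GMALL [::] (Γ ⇒ Top +` Δ)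
| R0 Γ Δ : GMALL [:: Γ ⇒ Δ] (Γ ⇒ Zero +` Δ)
| L1 Γ Δ : GMALL [:: Γ ⇒ Δ] (One +` Γ ⇒ Δ)
| LTensor Γ Δ A B :
    GMALL [:: A +` (B +` Γ) ⇒ Δ] ((A ⊗ B) +` Γ ⇒ Δ)
| RTensor Γ Γ' Δ Δ' A B :
    GMALL [:: Γ ⇒ A +` Δ; Γ' ⇒ B +` Δ']
          (Γ `+` Γ' ⇒ (A ⊗ B) +` (Δ `+` Δ'))
| LPar Γ Γ' Δ Δ' A B :
    GMALL [:: A +` Γ ⇒ Δ; B +` Γ' ⇒ Δ']
          ((A ⊕ B) +` (Γ `+` Γ') ⇒ Δ `+` Δ')
| RPar Γ Δ A B :
    GMALL [:: Γ ⇒ A +` (B +` Δ)] (Γ ⇒ (A ⊕ B) +` Δ)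
| LAnd1 Γ Δ A B : GMALL [:: A +` Γ ⇒ Δ] ((A ∧ B) +` Γ ⇒ Δ)
| LAnd2 Γ Δ A B : GMALL [:: B +` Γ ⇒ Δ] ((A ∧ B) +` Γ ⇒ Δ)
| RAnd Γ Δ A B :
    GMALL [:: Γ ⇒ A +` Δ; Γ ⇒ B +` Δ] (Γ ⇒ (A ∧ B) +` Δ)
| LOr Γ Δ A B :
    GMALL [:: A +` Γ ⇒ Δ; B +` Γ ⇒ Δ] ((A ∨ B) +` Γ ⇒ Δ)
| ROr1 Γ Δ A B : GMALL [:: Γ ⇒ A +` Δ] (Γ ⇒ (A ∨ B) +` Δ)
| ROr2 Γ Δ A B : GMALL [:: Γ ⇒ B +` Δ] (Γ ⇒ (A ∨ B) +` Δ)
| LNeg Γ Δ A : GMALL [:: Γ ⇒ A +` Δ] ((¬ A) +` Γ ⇒ Δ)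
| RNeg Γ Δ A : GMALL [:: A +` Γ ⇒ Δ] (Γ ⇒ (¬ A) +` Δ)
| LImp Γ Γ' Δ Δ' A B :
    GMALL [:: Γ ⇒ A +` Δ; B +` Γ' ⇒ Δ']
          ((A → B) +` (Γ `+` Γ') ⇒ Δ `+` Δ')
| RImp Γ Δ A B :
    GMALL [:: A +` Γ ⇒ B +` Δ] (Γ ⇒ (A → B) +` Δ).

Inductive GAMALL : calculus :=
| GMALL_GAMALL premises s : GMALL premises s -> GAMALL premises s
| LW Γ Δ A : GAMALL [:: Γ ⇒ Δ] (A +` Γ ⇒ Δ)
| RW Γ Δ A : GAMALL [:: Γ ⇒ Δ] (Γ ⇒ A +` Δ).

Definition Diamond (A : formula) : formula := ¬ A → A.

Notation "◇ A" := (Diamond A)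
  (at level 35, right associativity, format "◇ A") : mall_scope.

Definition Boxdot (A : formula) : formula := ¬ ◇ ¬ A.

Notation "⊡ A" := (Boxdot A)
  (at level 35, right associativity, format "⊡ A") : mall_scope.

(* Main.v *)
Require Import Defs.
From mathcomp Require Import all_boot finmap multiset.

(** In linear logic [◇ A], that is [¬ A → A], amounts to [A ⊕ A], and dually
    [⊡ A] amounts to [A ⊗ A].  The lemmas [diamond_right], [diamond_left],
    [boxdot_right] and [boxdot_left] are the corresponding rules.

    The point of the outer diamond in (1)-(5) is that [◇ (A → B)] unfolds to
    two copies of [A → B], so it suffices to derive [A, A ⇒ B, B]
    ([diamond_imp]).  This supplies by hand the duplication that affine logic
    does not allow as contraction.  Two copies of [A] on the left give
    [A, A ⇒ ⊡ A], and weakening adds the second succedent formula: this is (5),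
    of which (1) and (2) are instances.  For (3) each factor [◇ A] of [⊡ ◇ A]
    uses up one copy of [A]; and (4) is dual to (5).

    For (6) one has [⊡ A ⇒ A] and [⊡ B ⇒ B] by weakening, hence
    [A → ⊡ B, ⊡ A ⇒ B].  The diamond on the left merges two such derivations
    into one of [◇ (A → ⊡ B), ⊡ A, ⊡ A ⇒ B, B], which is what the diamond on
    the right asks for. *)

Set Implicit Arguments.
Unset Strict Implicit.
Unset Printing Implicit Defensive.

Local Notation "⊢ s" := (derivable_sequent GAMALL s) (at level 75).

Lemma by_axiom s : GMALL [::] s -> ⊢ s.
Proof. by move=> r; apply: derivable_by (GMALL_GAMALL r) _. Qed.

Lemma by_rule1 p s : GAMALL [:: p] s -> ⊢ p -> ⊢ s.
Proof.
by move=> r dp; apply: derivable_by r _ => q; rewrite inE => /eqP ->.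
Qed.

Lemma by_rule2 p p' s : GAMALL [:: p; p'] s -> ⊢ p -> ⊢ p' -> ⊢ s.
Proof.
by move=> r dp dp'; apply: derivable_by r _ => q; rewrite !inE => /orP[] /eqP ->.
Qed.

Section Rules.
Implicit Types (A B : formula) (Γ Δ : {mset formula}).

Lemma identity A : ⊢ ([mset A] ⇒ [mset A]).
Proof. exact/by_axiom/Ax. Qed.

Lemma weaken_left Γ Δ A : ⊢ (Γ ⇒ Δ) -> ⊢ (A +` Γ ⇒ Δ).
Proof. exact/by_rule1/LW. Qed.

Lemma weaken_right Γ Δ A : ⊢ (Γ ⇒ Δ) -> ⊢ (Γ ⇒ A +` Δ).
Proof. exact/by_rule1/RW. Qed.

Lemma neg_left Γ Δ A : ⊢ (Γ ⇒ A +` Δ) -> ⊢ ((¬ A) +` Γ ⇒ Δ).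
Proof. exact/by_rule1/GMALL_GAMALL/LNeg. Qed.

Lemma neg_right Γ Δ A : ⊢ (A +` Γ ⇒ Δ) -> ⊢ (Γ ⇒ (¬ A) +` Δ).
Proof. exact/by_rule1/GMALL_GAMALL/RNeg. Qed.

Lemma imp_left Γ Γ' Δ Δ' A B :
  ⊢ (Γ ⇒ A +` Δ) -> ⊢ (B +` Γ' ⇒ Δ') ->
  ⊢ ((A → B) +` (Γ `+` Γ') ⇒ Δ `+` Δ').
Proof. exact/by_rule2/GMALL_GAMALL/LImp. Qed.

Lemma imp_right Γ Δ A B : ⊢ (A +` Γ ⇒ B +` Δ) -> ⊢ (Γ ⇒ (A → B) +` Δ).
Proof. exact/by_rule1/GMALL_GAMALL/RImp. Qed.

Lemma diamond_right Γ Δ A : ⊢ (Γ ⇒ A +` (A +` Δ)) -> ⊢ (Γ ⇒ (◇ A) +` Δ).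
Proof. by move=> d; apply/imp_right/neg_left. Qed.

Lemma diamond_left Γ Γ' Δ Δ' A :
  ⊢ (A +` Γ ⇒ Δ) -> ⊢ (A +` Γ' ⇒ Δ') ->
  ⊢ ((◇ A) +` (Γ `+` Γ') ⇒ Δ `+` Δ').
Proof. by move=> d d'; apply: imp_left => //; apply: neg_right. Qed.

Lemma boxdot_left Γ Δ A : ⊢ (A +` (A +` Γ) ⇒ Δ) -> ⊢ ((⊡ A) +` Γ ⇒ Δ).
Proof. by move=> d; apply/neg_left/diamond_right/neg_right/neg_right. Qed.

Lemma boxdot_right Γ Γ' Δ Δ' A :
  ⊢ (Γ ⇒ A +` Δ) -> ⊢ (Γ' ⇒ A +` Δ') ->
  ⊢ (Γ `+` Γ' ⇒ (⊡ A) +` (Δ `+` Δ')).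
Proof. by move=> d d'; apply/neg_right/diamond_left; apply: neg_left. Qed.

(** The diamond around an implication makes two copies of its antecedent and of
    its succedent available. *)
Lemma diamond_imp Γ A B :
  ⊢ (A +` (A +` Γ) ⇒ B +` [mset B]) -> ⊢ (Γ ⇒ [mset ◇ (A → B)]).
Proof.
move=> d; rewrite -[X in _ ⇒ X]msetD0; apply/diamond_right/imp_right.
by rewrite msetDCA; apply: imp_right; rewrite msetD0.
Qed.

Lemma boxdot_elim A : ⊢ ([mset ⊡ A] ⇒ [mset A]).
Proof.
rewrite -[X in X ⇒ _]msetD0; apply/boxdot_left/weaken_left.
by rewrite msetD0; apply: identity.
Qed.

Lemma diamond_intro A : ⊢ ([mset A] ⇒ [mset ◇ A]).
Proof.
rewrite -[X in _ ⇒ X]msetD0; apply/diamond_right/weaken_right.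
by rewrite msetD0; apply: identity.
Qed.

(** Each factor of the product [⊡ B] consumes its own copy of [A]. *)
Lemma boxdot_double A B :
  ⊢ ([mset A] ⇒ [mset B]) -> ⊢ (A +` [mset A] ⇒ [mset ⊡ B]).
Proof.
have := @boxdot_right [mset A] [mset A] mset0 mset0 B.
by rewrite !msetD0 => rule d; apply: rule.
Qed.

Lemma diamond_double A : ⊢ ([mset ◇ A] ⇒ A +` [mset A]).
Proof.
have := @diamond_left mset0 mset0 [mset A] [mset A] A.
by rewrite !msetD0; apply; apply: identity.
Qed.

(** The common form of (1), (2), (3) and (5). *)
Lemma diamond_imp_boxdot A B :
  ⊢ ([mset A] ⇒ [mset B]) -> derivable GAMALL (◇ (A → ⊡ B)).
Proof.
by move=> d; apply/diamond_imp/weaken_right; rewrite msetD0; apply: boxdot_double.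
Qed.

End Rules.

Theorem mainTheorem11 (A B : formula) :
  derivable GAMALL (◇ (⊡ A → ⊡ ⊡ A)) /\
  derivable GAMALL (◇ (◇ A → ⊡ ◇ A)) /\
  derivable GAMALL (◇ (A → ⊡ ◇ A)) /\
  derivable GAMALL (◇ (◇ A → A)) /\
  derivable GAMALL (◇ (A → ⊡ A)) /\
  derivable GAMALL (◇ (A → ⊡ B) → ◇ (⊡ A → B)).
Proof.
split; first exact/diamond_imp_boxdot/identity.
split; first exact/diamond_imp_boxdot/identity.
split; first exact/diamond_imp_boxdot/diamond_intro.
split.
  by apply/diamond_imp/weaken_left; rewrite msetD0; apply: diamond_double.
split; first exact/diamond_imp_boxdot/identity.
have half : ⊢ ((A → ⊡ B) +` [mset ⊡ A] ⇒ [mset B]).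
  have := @imp_left [mset ⊡ A] mset0 mset0 [mset B] A (⊡ B).
  by rewrite !msetD0 mset0D; apply; apply: boxdot_elim.
rewrite /derivable -[X in _ ⇒ X]msetD0; apply: imp_right; rewrite !msetD0.
apply: diamond_imp.
(* [◇ (A → ⊡ B)] moves to the front, where the left rule expects it. *)
rewrite msetDA msetDC.
by apply: diamond_left; apply: half.
Qed.
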